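(* Let $Q$ be an acyclic quiver, and let $\mathscr{C}(S_Q)$ be the lattice of all congruences on its path semigroup $S_Q$. Then the following statements are equivalent. (1) There are at most two paths from one vertex to another (i.e. for any two vertices $a,b$ of $Q$ there are at most two paths from $a$ to $b$). (2) $\mathscr{C}(S_Q)$ is modular. (3) $\mathscr{C}(S_Q)$ is strong lower semimodular. (4) $\mathscr{C}(S_Q)$ is lower semimodular.
   Context: A quiver $Q=(Q_0,Q_1,s,t)$ consists of a set $Q_0$ of vertices, a set $Q_1$ of arrows, and source and target maps $s,t:Q_1\to Q_0$; it is not necessarily finite. It is acyclic if it has no oriented cycle, i.e. no path of length at least $1$ whose source equals its target. Paths are finite and include the trivial path at each vertex (identified with the vertex). Paths are composed from left to right: $\alpha\beta$ is the concatenation if $t(\alpha)=s(\beta)$ and is $0$ otherwise. The path semigroup $S_Q$ is the semigroup with zero whose nonzero elements are all paths in $Q$, with this multiplication. A congruence on a semigroup $S$ is an equivalence relation $\rho$ such that $(x,y)\in\rho$ implies $(ax,ay)\in\rho$ and $(xa,ya)\in\rho$ for all $a\in S$. $\mathscr{C}(S_Q)$ is the set of all congruences on $S_Q$, which is a complete lattice under inclusion. In a lattice $L$, $a\succ b$ ($a$ covers $b$) means $a>b$ and there is no $c\in L$ with $a>c>b$. $L$ is modular if $a\le c$ implies $(a\vee b)\wedge c=a\vee(b\wedge c)$ for all $a,b,c\in L$. $L$ is strong lower semimodular if $a\vee b\succ a$ implies $b\succ a\wedge b$ for all $a,b\in L$. $L$ is lower semimodular if, for all $a,b\in L$, $a\vee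 b\succ a$ and $a\vee b\succ b$ together imply $a\succ a\wedge b$ and $b\succ a\wedge b$. *)

(* Defs.v *)
From HB Require Import structures.
From mathcomp Require Import all_boot all_order.
From mathcomp Require Import boolp.

Set Implicit Arguments.
Unset Strict Implicit.
Unset Printing Implicit Defensive.

Import Order.TTheory.

Local Open Scope group_scope.

Record quiver := Quiver {
  vertex : Type;
  arrow : Type;
  source : arrow -> vertex;
  target : arrow -> vertex
}.

Fixpoint is_walk (Q : quiver) (a : vertex Q) (s : seq (arrow Q))
    (b : vertex Q) : Prop :=
  if s is x :: s' then source x = a /\ is_walk (target x) s' b else a = b.

(* The endpoints are recorded because an empty list of arrows does not
   determine its base vertex: [QPath a a [::] erefl] is the trivial path at
   [a].  By proof irrelevance a path is its endpoints and list of arrows. *)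
Record qpath (Q : quiver) := QPath {
  psource : vertex Q;
  ptarget : vertex Q;
  parrows : seq (arrow Q);
  pwalk : is_walk psource parrows ptarget
}.

Definition plength (Q : quiver) (p : qpath Q) : nat := size (parrows p).

Definition acyclic (Q : quiver) : Prop :=
  forall p : qpath Q, (0 < plength p)%N -> psource p <> ptarget p.

Definition at_most_two_paths (Q : quiver) : Prop :=
  forall (a b : vertex Q) (p q r : qpath Q),
    psource p = a -> ptarget p = b ->
    psource q = a -> ptarget q = b ->
    psource r = a -> ptarget r = b ->
    p = q \/ p = r \/ q = r.

Lemma qpath_eq (Q : quiver) (p q : qpath Q) :
  psource p = psource q -> ptarget p = ptarget q -> parrows p = parrows q ->
  p = q.
Proof.
case: p q => [a b s w] [a' b' s' w'] /= ea eb es; move: w w'.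
by rewrite ea eb es => w w'; congr QPath; apply: Prop_irrelevance.
Qed.

Lemma is_walk_cat (Q : quiver) (a b c d : vertex Q) (s1 s2 : seq (arrow Q)) :
  is_walk a s1 b -> is_walk c s2 d -> b = c -> is_walk a (s1 ++ s2) d.
Proof.
move=> w1 w2 ebc; elim: s1 a w1 => [|x s1 IH] a /=.
  by move=> ->; rewrite ebc.
by case=> <- /IH.
Qed.

Definition pcat (Q : quiver) (p q : qpath Q) (e : ptarget p = psource q) :
    qpath Q :=
  QPath (is_walk_cat (pwalk p) (pwalk q) e).

(* [None] is the zero element. *)
Definition path_semigroup (Q : quiver) : Type := option (qpath Q).

Definition pmul (Q : quiver) (x y : path_semigroup Q) : path_semigroup Q :=
  match x, y with
  | Some p, Some q =>
      match pselect (ptarget p = psource q) with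
      | left e => Some (pcat e)
      | right _ => None
      end
  | _, _ => None
  end.

Lemma pmulA (Q : quiver) : associative (@pmul Q).
Proof.
case=> [p|] [q|] [r|] //=; last by case: pselect.
case: (pselect (ptarget q = psource r)) => [eqr|nqr] /=;
  case: (pselect (ptarget p = psource q)) => [epq|npq] //=.
- case: pselect => [e1|//].
  by congr Some; apply: qpath_eq => //=; rewrite catA.
- by case: pselect.
Qed.

HB.instance Definition _ (Q : quiver) := gen_eqMixin (path_semigroup Q).
HB.instance Definition _ (Q : quiver) := gen_choiceMixin (path_semigroup Q).
HB.instance Definition _ (Q : quiver) :=
  isSemigroup.Build (path_semigroup Q) (@pmulA Q).

Record congruence (S : semigroupType) := Congruence {
  crel :> S -> S -> Prop;
  crel_refl : forall x, crel x x;
  crel_sym : forall x y, crel x y -> crel y x;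
  crel_trans : forall x y z, crel x y -> crel y z -> crel x z;
  crel_mull : forall a x y, crel x y -> crel (a * x) (a * y);
  crel_mulr : forall a x y, crel x y -> crel (x * a) (y * a)
}.

HB.instance Definition _ (S : semigroupType) := gen_eqMixin (congruence S).
HB.instance Definition _ (S : semigroupType) := gen_choiceMixin (congruence S).

Lemma congruence_eq (S : semigroupType) (r s : congruence S) :
  (forall x y, r x y <-> s x y) -> r = s.
Proof.
case: r s => [r r1 r2 r3 r4 r5] [s s1 s2 s3 s4 s5] /= ers.
have {ers} e : r = s by apply/funext => x; apply/funext => y; apply/propext.
subst s; congr Congruence; exact: Prop_irrelevance.
Qed.

Definition csub (S : semigroupType) (r s : congruence S) : Prop :=
  forall x y, r x y -> s x y.

Definition cle (S : semigroupType) (r s : congruence S) : bool :=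
  `[< csub r s >].

Lemma cle_refl (S : semigroupType) : reflexive (@cle S).
Proof. by move=> r; apply/asboolP. Qed.

Lemma cle_anti (S : semigroupType) : antisymmetric (@cle S).
Proof.
move=> r s /andP[/asboolP rs /asboolP sr].
by apply: congruence_eq => x y; split; [apply: rs | apply: sr].
Qed.

Lemma cle_trans (S : semigroupType) : transitive (@cle S).
Proof.
by move=> s r t /asboolP rs /asboolP st; apply/asboolP => x y /rs/st.
Qed.

Fact congruence_display : Order.disp_t. Proof. exact: Order.Disp tt tt. Qed.

HB.instance Definition _ (S : semigroupType) :=
  Order.Le_isPOrder.Build congruence_display (congruence S)
    (@cle_refl S) (@cle_anti S) (@cle_trans S).

Definition cInf (S : semigroupType) (F : congruence S -> Prop) : congruence S.
Proof.
apply: (@Congruence S (fun x y => forall r : congruence S, F r -> r x y)).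
- by move=> x r _; apply: crel_refl.
- by move=> x y h r /h; apply: crel_sym.
- by move=> x y z h k r Fr; apply: crel_trans (h r Fr) (k r Fr).
- by move=> a x y h r /h; apply: crel_mull.
- by move=> a x y h r /h; apply: crel_mulr.
Defined.

Definition cmeet (S : semigroupType) (r s : congruence S) : congruence S :=
  cInf (fun t => t = r \/ t = s).

Definition cjoin (S : semigroupType) (r s : congruence S) : congruence S :=
  cInf (fun t => csub r t /\ csub s t).

Lemma cle_meet (S : semigroupType) (r s t : congruence S) :
  (r <= cmeet s t)%O = (r <= s)%O && (r <= t)%O.
Proof.
apply/asboolP/andP => [h | [/asboolP rs /asboolP rt]].
  by split; apply/asboolP => x y /h; apply; [left | right].
by move=> x y rxy u [->|->]; [apply: rs | apply: rt].
Qed.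

Lemma cjoin_le (S : semigroupType) (r s t : congruence S) :
  (cjoin r s <= t)%O = (r <= t)%O && (s <= t)%O.
Proof.
apply/asboolP/andP => [h | [/asboolP rt /asboolP st]].
  by split; apply/asboolP => x y xy; apply: h => u [ru su];
    [apply: ru | apply: su].
by move=> x y; apply.
Qed.

HB.instance Definition _ (S : semigroupType) :=
  Order.POrder_MeetJoin_isLattice.Build congruence_display (congruence S)
    (@cle_meet S) (@cjoin_le S).

Local Open Scope order_scope.

Definition covers (d : Order.disp_t) (L : latticeType d) (a b : L) : Prop :=
  b < a /\ ~ (exists c : L, b < c /\ c < a).

Definition modular (d : Order.disp_t) (L : latticeType d) : Prop :=
  forall a b c : L, a <= c -> (a `|` b) `&` c = a `|` (b `&` c).

Definition strong_lower_semimodular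
    (d : Order.disp_t) (L : latticeType d) : Prop :=
  forall a b : L, covers (a `|` b) a -> covers b (a `&` b).

Definition lower_semimodular (d : Order.disp_t) (L : latticeType d) : Prop :=
  forall a b : L, covers (a `|` b) a -> covers (a `|` b) b ->
    covers a (a `&` b) /\ covers b (a `&` b).

(* Main.v *)
(** Congruent paths that are not congruent to zero are parallel, because
    multiplying by the trivial path at an endpoint kills every path that does
    not have this endpoint.  With at most two parallel paths, this makes joins
    computable: two elements are related by [r `|` s] iff they are equal, related
    by [r] or [s], or each reaches zero in two steps, and modularity is a case
    check.

    Conversely, suppose that there are three parallel paths p, q, r from a to b.
    The elements having no multiple among the paths from a to b form an ideal,
    and by acyclicity a left or right factor either fixes all paths from a to b
    or sends them all into this ideal.  Hence every partition of the ideal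
    together with the paths from a to b, in which the ideal lies in one block,
    gives a congruence.  The partitions pq|rest and pr|rest are both covered by
    their join, but pq|r|rest lies strictly between the first and their meet. *)
Require Import Defs.
From mathcomp Require Import all_boot all_order.
From mathcomp Require Import boolp.

Set Implicit Arguments.
Unset Strict Implicit.
Unset Printing Implicit Defensive.

Import Order.TTheory.

Local Open Scope group_scope.

(** * Modularity and lower semimodularity in an arbitrary lattice *)

Section Lattice.
Local Open Scope order_scope.
Variables (d : Order.disp_t) (L : latticeType d).

(** If [c] is strictly between the meet and [b], then the join of [a] and [c] is strictly between
    [a] and the full join: were it the full join, modularity for [c <= b] would give [c = b]. *)
Lemma modular_strong_lower_semimodular :
  modular L -> strong_lower_semimodular L.
Proof.
move=> modL a b [lt_a_ab nomid]; split.
  rewrite lt_neqAle leIr andbT; apply: contraL lt_a_ab => /eqP eab.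
  by rewrite -[X in _ `|` X]eab meetKU ltxx.
case=> c [lt_ab_c lt_c_b]; apply: nomid; exists (a `|` c).
have [le_ab_c le_cb] := (ltW lt_ab_c, ltW lt_c_b).
rewrite !lt_neqAle leUl leU2 // !andbT; split.
  apply: contraL lt_ab_c => /eqP ea.
  have le_ca : c <= a by rewrite ea leUr.
  by rewrite le_gtF // lexI le_ca le_cb.
apply: contraTneq lt_c_b => eacb.
have := modL c a b le_cb.
rewrite (joinC c a) eacb joinIK => ->.
by rewrite (join_l le_ab_c) ltxx.
Qed.

Lemma strong_lower_semimodular_lower_semimodular :
  strong_lower_semimodular L -> lower_semimodular L.
Proof.
move=> slm a b cova covb; split; last exact: slm.
by rewrite meetC; apply: slm; rewrite joinC.
Qed.

End Lattice.

(** * Inclusion, joins and meets of congruences *)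

Section CongruenceLattice.
Variable S : semigroupType.
Implicit Types r s t : congruence S.

Lemma cle_csub r s : (r <= s)%O -> csub r s.
Proof. by move/asboolP. Qed.

Lemma csub_cle r s : csub r s -> (r <= s)%O.
Proof. by move=> ?; apply/asboolP. Qed.

Lemma cjoinl r s : csub r (r `|` s)%O.
Proof. exact/cle_csub/leUl. Qed.

Lemma cjoinr r s : csub s (r `|` s)%O.
Proof. exact/cle_csub/leUr. Qed.

Lemma cmeetP r s x y : (r `&` s)%O x y <-> r x y /\ s x y.
Proof.
change ((r `&` s)%O x y) with (cmeet r s x y).
split=> [rs|[rxy sxy] t [->|->] //].
by split; apply: rs; [left | right].
Qed.

Lemma ctrans r x y z : r x y -> r y z -> r x z.
Proof. exact: crel_trans. Qed.

End CongruenceLattice.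

(** * Congruences from partitions of an ideal with extra elements *)

Section IdealPartition.
Variables (S : semigroupType) (I T : S -> Prop).
Hypothesis idl : forall m x, I x -> I (m * x).
Hypothesis idr : forall m x, I x -> I (x * m).
Hypothesis actl :
  forall m, (forall x, T x -> m * x = x) \/ (forall x, T x -> I (m * x)).
Hypothesis actr :
  forall m, (forall x, T x -> x * m = x) \/ (forall x, T x -> I (x * m)).

Let K x := I x \/ T x.

Section Partition.
Variables (A : Type) (h : S -> A).
Hypothesis hI : forall x y, I x -> I y -> h x = h y.

(** Labels in an arbitrary type encode the partition of [K], so that one construction serves for
    one, two or three blocks. *)
Definition fiber_rel x y := x = y \/ [/\ K x, K y & h x = h y].

Fact fiber_refl x : fiber_rel x x. Proof. by left. Qed.

Fact fiber_sym x y : fiber_rel x y -> fiber_rel y x.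
Proof. by case=> [->|[]]; [left | right]. Qed.

Fact fiber_trans x y z : fiber_rel x y -> fiber_rel y z -> fiber_rel x z.
Proof.
case=> [->//|[Kx Ky exy]] [<-|[_ Kz eyz]]; first by right.
by right; split; rewrite // exy.
Qed.

(** The map [f] stands for a left or a right factor. Either it preserves labels on [K], or it sends
    [K] into [I], where labels are constant. *)
Fact fiber_act (f : S -> S) : (forall x, I x -> I (f x)) ->
    (forall x, T x -> f x = x) \/ (forall x, T x -> I (f x)) ->
  forall x y, fiber_rel x y -> fiber_rel (f x) (f y).
Proof.
move=> fI fT x y [->|[Kx Ky exy]]; first by left.
right; case: fT => fT.
  have fK z : K z -> K (f z) /\ h (f z) = h z.
    case=> [Iz|Tz]; last by rewrite fT //; split; first right.
    by split; [left; apply: fI | apply: hI => //; apply: fI].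
  by have [[? ->] [? ->]] := (fK x Kx, fK y Ky).
have fK z : K z -> I (f z) by case=> [/fI|/fT].
by split; [left; apply: fK | left; apply: fK | apply: hI; apply: fK].
Qed.

Definition fiber_congruence : congruence S :=
  Congruence fiber_refl fiber_sym fiber_trans
    (fun m => fiber_act (idl m) (actl m)) (fun m => fiber_act (idr m) (actr m)).

End Partition.

(** A strictly larger congruence inside the one-block one identifies two elements of [K] with
    different labels; there being only two labels, it identifies all of [K]. *)
Lemma fiber_congruence_covers (h : S -> bool)
    (hI : forall x y, I x -> I y -> h x = h y) (x0 y0 : S) :
  K x0 -> K y0 -> h x0 != h y0 ->
  covers (fiber_congruence (h := fun=> tt) (fun _ _ _ _ => erefl))
    (fiber_congruence hI).
Proof.
move=> Kx0 Ky0 neq0; split.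
  rewrite lt_neqAle; apply/andP; split; last first.
    by apply: csub_cle => x y [->|[Kx Ky _]]; [left | right].
  apply/eqP => e.
  have : fiber_congruence hI x0 y0 by rewrite e; right.
  by case=> [exy|[_ _ exy]]; move: neq0; rewrite exy eqxx.
case=> c [lt_hc lt_cf].
have /existsNP[x /existsNP[y /not_implyP[cxy nhxy]]] :
    ~ csub c (fiber_congruence hI).
  by move=> /csub_cle/le_gtF; rewrite lt_hc.
have [exy|[Kx Ky _]] := cle_csub (ltW lt_cf) cxy.
  by case: nhxy; rewrite exy; left.
have nexy : h x != h y by apply/eqP => exy; apply: nhxy; right.
have hc z w : K z -> K w -> h z = h w -> c z w.
  by move=> Kz Kw ezw; apply: (cle_csub (ltW lt_hc)); right.
have cx z : K z -> c x z.
  move=> Kz; have [exz|nexz] := eqVneq (h x) (h z); first exact: hc.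
  apply: ctrans cxy _; apply: hc => //.
  by move: nexz nexy; case: (h x) (h y) (h z) => [] [] [].
suff : csub (fiber_congruence (h := fun=> tt) (fun _ _ _ _ => erefl)) c.
  by move=> /csub_cle/le_gtF; rewrite lt_cf.
move=> z w [->|[Kz Kw _]]; first exact: crel_refl.
exact: ctrans (crel_sym (cx z Kz)) (cx w Kw).
Qed.

Lemma not_lower_semimodular_ideal (o p q r : S) :
  I o -> (forall x, T x -> ~ I x) -> T p -> T q -> T r ->
  p <> q -> p <> r -> q <> r -> ~ lower_semimodular (congruence S).
Proof.
move=> Io TI Tp Tq Tr npq npr nqr lsm.
have [nop noq nor] : [/\ o <> p, o <> q & o <> r].
  by split=> eo; move: Io; rewrite eo; apply: TI.
have nI x u : T u -> I x -> (x == u) = false.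
  by move=> Tu Ix; apply/eqP => eu; apply: (TI u) => //; rewrite -eu.
pose h1 x := (x == p) || (x == q); pose h2 x := (x == p) || (x == r).
have h1I x y : I x -> I y -> h1 x = h1 y.
  by move=> Ix Iy; rewrite /h1 !nI.
have h2I x y : I x -> I y -> h2 x = h2 y.
  by move=> Ix Iy; rewrite /h2 !nI.
have h3I x y : I x -> I y -> (h1 x, x == r) = (h1 y, y == r).
  by move=> Ix Iy; rewrite /h1 !nI.
have [Ko Kp Kq Kr] : [/\ K o, K p, K q & K r].
  by split; [left | right | right | right].
have E : (p == q = false) * (q == p = false) * (p == r = false) *
    (r == p = false) * (q == r = false) * (r == q = false) *
    (o == p = false) * (o == q = false) * (o == r = false).
  by do !split; apply/eqP => // /esym.
pose a := fiber_congruence h1I; pose b := fiber_congruence h2I.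
pose c := fiber_congruence h3I.
pose f := fiber_congruence (h := fun=> tt) (fun _ _ _ _ => erefl).
have join_ab : (a `|` b)%O = f.
  apply/eqP; rewrite eq_le leUx; apply/andP; split.
    by apply/andP; split; apply: csub_cle => x y [->|[Kx Ky _]];
      by [left | right].
  (* Elements outside the block of [p] and [q] are [a]-related to [r]; those inside go to [p] by
     [a], then to [r] by [b]. *)
  have toR x : K x -> (a `|` b)%O x r.
    move=> Kx; case e : (h1 x); last first.
      by apply: cjoinl; right; split=> //; rewrite e /h1 !E.
    apply: (@ctrans _ _ _ p).
      by apply: cjoinl; right; split=> //; rewrite e /h1 eqxx.
    by apply: cjoinr; right; split=> //; rewrite /h2 !eqxx orbT.
  apply: csub_cle => x y [->|[Kx Ky _]]; first exact: crel_refl.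
  exact: ctrans (toR x Kx) (crel_sym (toR y Ky)).
have [||[_ nomid] _] := lsm a b; rewrite ?join_ab.
- by apply: (@fiber_congruence_covers _ _ p r); rewrite // /h1 !E eqxx.
- by apply: (@fiber_congruence_covers _ _ p q); rewrite // /h2 !E eqxx.
(* The pair [p], [q] separates [c] from the meet, and the pair [o], [r] separates it from [a]. *)
apply: nomid; exists c; split; rewrite lt_neqAle; apply/andP; split.
- apply/eqP => e.
  have : (a `&` b)%O p q by rewrite e; right; split; rewrite // /h1 !E !eqxx.
  by case/cmeetP=> _ [//|[_ _]]; rewrite /h2 !E eqxx.
- apply: csub_cle => x y /cmeetP[[->|[Kx Ky e1]]]; first by left.
  case=> [->|[_ _ e2]]; first by left.
  right; split=> //; congr pair => //.
  (* If exactly one of [x], [y] is [p], then [h1] forces the other to be [q]; if neither is, [h2]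
     tests equality with [r]. *)
  move: e1 e2; rewrite /h1 /h2.
  case: (eqVneq x p) (eqVneq y p) => [->|nx] [->|ny]; rewrite ?E ?eqxx //=.
    by move=> /esym/eqP->; rewrite E.
  by move=> /eqP->; rewrite E.
- apply/eqP => e.
  have : c o r by rewrite e; right; split; rewrite // /h1 !E.
  by case=> [//|[_ _]]; rewrite !E eqxx; case.
- apply: csub_cle => x y [->|[Kx Ky [e _]]]; first by left.
  by right.
Qed.

End IdealPartition.

(** * Products of paths and parallel paths *)

Section PathSemigroup.
Variable Q : quiver.
Local Notation SQ := (path_semigroup Q).

Lemma mul0p (x : SQ) : (None : SQ) * x = None. Proof. by []. Qed.

Lemma mulp0 (x : SQ) : x * (None : SQ) = None. Proof. by case: x. Qed.

Lemma pmul_SomeE (x y : SQ) w : x * y = Some w ->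
  exists p q (e : ptarget p = psource q),
    [/\ x = Some p, y = Some q & w = pcat e].
Proof.
case: x y => [p|] [q|] //; rewrite /mul /=; case: pselect => // e [<-].
by exists p, q, e.
Qed.

Lemma pmul_eq0 p q :
  ptarget p <> psource q -> (Some p : SQ) * (Some q : SQ) = None.
Proof. by rewrite /mul /=; case: pselect. Qed.

Definition trivial_path (a : vertex Q) : qpath Q :=
  @QPath Q a a [::] erefl.

Definition vertex_elt (a : vertex Q) : SQ := Some (trivial_path a).

Lemma trivial_pmul p : vertex_elt (psource p) * (Some p : SQ) = Some p.
Proof.
rewrite /mul /=; case: pselect => //= e.
by congr Some; apply: qpath_eq.
Qed.

Lemma pmul_trivial p : (Some p : SQ) * vertex_elt (ptarget p) = Some p.
Proof.
rewrite /mul /=; case: pselect => //= e.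
by congr Some; apply: qpath_eq; rewrite //= cats0.
Qed.

Definition parallel (x y : SQ) : Prop :=
  if (x, y) is (Some p, Some q) then
    psource p = psource q /\ ptarget p = ptarget q
  else False.

Lemma parallel_sym x y : parallel x y -> parallel y x.
Proof. by case: x y => [p|] [q|] //= []. Qed.

Lemma congruence_nonzero_parallel (r : congruence SQ) x y :
  r x y -> r x None /\ r y None \/ parallel x y.
Proof.
have main p q : r (Some p) (Some q) ->
    parallel (Some p) (Some q) \/ r (Some p) None.
  move=> rpq; case: (pselect (psource p = psource q)) => [es|ns].
    case: (pselect (ptarget p = ptarget q)) => [et|nt]; first by left.
    right; rewrite -(pmul_trivial p).
    rewrite -(@pmul_eq0 q (trivial_path (ptarget p))); first exact: crel_mulr.
    by move=> e; apply: nt.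
  right; rewrite -(trivial_pmul p).
  by rewrite -(@pmul_eq0 (trivial_path (psource p)) q) //; apply: crel_mull.
case: x y => [p|] [q|] rxy.
- have [|r0] := main _ _ rxy; first by right.
  by left; split=> //; apply: ctrans (crel_sym rxy) r0.
- by left; split=> //; apply: crel_refl.
- by left; split; [apply: crel_refl | apply: crel_sym].
- by left.
Qed.

(** * Joins and modularity with at most two parallel paths *)

Section AtMostTwo.
Hypothesis two : at_most_two_paths Q.

Lemma parallel_two x y z :
  parallel x y -> parallel y z -> [\/ x = y, x = z | y = z].
Proof.
case: x y z => [p|] [q|] [s|] //= [e1 e2] // [e3 e4].
have := @two (psource q) (ptarget q) p q s.
case=> // [->|[->|->]]; by [constructor 1 | constructor 2 | constructor 3].
Qed.

Section Join.
Variables r s : congruence SQ.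

Definition step x y := r x y \/ s x y.

(** Two steps suffice since a path has at most one other path parallel to it, the only possible
    detour on the way to zero. *)
Definition near_zero x := exists2 z, step x z & step z None.

Definition join_rel x y :=
  [\/ x = y, step x y | near_zero x /\ near_zero y].

Lemma step_refl x : step x x. Proof. by left; apply: crel_refl. Qed.

Lemma step_sym x y : step x y -> step y x.
Proof. by case=> h; [left | right]; apply: crel_sym. Qed.

Lemma step_cases x y : step x y -> step x None /\ step y None \/ parallel x y.
Proof.
by case=> /[dup] h /congruence_nonzero_parallel[[hx hy]|?];
  [left; split; left | right | left; split; right | right].
Qed.

(** A third step can be saved: a step between nonparallel elements puts both one step from zero, and
    of three parallel elements two coincide. *)
Lemma step_near_zero x y : step x y -> near_zero y -> near_zero x.
Proof.
move=> xy [z yz z0].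
have [[x0 _]|pxy] := step_cases xy; first by exists x => //; apply: step_refl.
have [[y0 _]|pyz] := step_cases yz; first by exists y.
case: (parallel_two pxy pyz) => e; subst.
- by exists z.
- by exists z => //; apply: step_refl.
- by exists z.
Qed.

Lemma step_trans x y z : step x y -> step y z -> join_rel x z.
Proof.
move=> xy yz.
have nz w : step w None -> near_zero w by exists w => //; apply: step_refl.
have [[x0 y0]|pxy] := step_cases xy.
  constructor 3; split; first exact: nz.
  by apply: step_near_zero (step_sym yz) _; apply: nz.
have [[y0 z0]|pyz] := step_cases yz.
  constructor 3; split; last exact: nz.
  by apply: step_near_zero xy _; apply: nz.
by case: (parallel_two pxy pyz) => e; subst;
  [constructor 2 | constructor 1 | constructor 2].
Qed.

Fact join_refl x : join_rel x x. Proof. by constructor 1. Qed.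

Fact join_sym x y : join_rel x y -> join_rel y x.
Proof.
by case=> [->|/step_sym|[]]; [constructor 1 | constructor 2 | constructor 3].
Qed.

Fact join_trans x y z : join_rel x y -> join_rel y z -> join_rel x z.
Proof.
case=> [->//|xy|[nx ny]] [<-|yz|[ny' nz]].
- by constructor 2.
- exact: step_trans xy yz.
- by constructor 3; split=> //; apply: step_near_zero ny'.
- by constructor 3.
- by constructor 3; split=> //; apply: step_near_zero (step_sym yz) ny.
- by constructor 3.
Qed.

Fact join_mull m x y : join_rel x y -> join_rel (m * x) (m * y).
Proof.
have stepM u v : step u v -> step (m * u) (m * v).
  by case=> h; [left | right]; apply: crel_mull.
have nearM u : near_zero u -> near_zero (m * u).
  case=> v /stepM uv /stepM; rewrite mulp0; by exists (m * v).
case=> [->|/stepM|[/nearM ? /nearM]].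
- by constructor 1.
- by constructor 2.
- by constructor 3.
Qed.

Fact join_mulr m x y : join_rel x y -> join_rel (x * m) (y * m).
Proof.
have stepM u v : step u v -> step (u * m) (v * m).
  by case=> h; [left | right]; apply: crel_mulr.
have nearM u : near_zero u -> near_zero (u * m).
  case=> v /stepM uv /stepM; rewrite mul0p; by exists (v * m).
case=> [->|/stepM|[/nearM ? /nearM]].
- by constructor 1.
- by constructor 2.
- by constructor 3.
Qed.

Definition join_congruence :=
  Congruence join_refl join_sym join_trans join_mull join_mulr.

Lemma cjoin_join_rel x y : (r `|` s)%O x y -> join_rel x y.
Proof.
apply: (cle_csub (s := join_congruence)).
by rewrite leUx; apply/andP; split; apply: csub_cle => u v uv;
  constructor 2; [left | right].
Qed.

End Join.

Lemma at_most_two_modular : modular (congruence SQ).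
Proof.
move=> a b c le_ac; have ac := cle_csub le_ac.
apply/eqP; rewrite eq_le; apply/andP; split; last first.
  by rewrite leUx !lexI leUl le_ac leIr (le_trans (leIl _ _) (leUr _ _)).
apply: csub_cle => x y /cmeetP[/cjoin_join_rel jxy cxy].
set j := (a `|` (b `&` c))%O.
have aj u v : a u v -> j u v by apply: cjoinl.
have bj u v : b u v -> c u v -> j u v.
  by move=> buv cuv; apply: cjoinr; apply/cmeetP.
have stepj u v : step a b u v -> c u v -> j u v by case=> [/aj|/bj].
case: jxy => [->|xy|[nx ny]]; first exact: crel_refl.
  exact: stepj.
(* If one of the two steps is in [a], hence in [c], then [c] also relates [w] to zero, so that both
   steps lie in [j]; two [b]-steps compose within [b]. *)
have zero u : near_zero a b u -> c u None -> j u None.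
  move=> [w [auw|buw] w0] cu.
    apply: ctrans (aj _ _ auw) _; apply: stepj w0 _.
    exact: ctrans (crel_sym (ac _ _ auw)) cu.
  case: w0 => [aw|bw].
    apply: ctrans (aj _ _ aw); apply: bj buw _.
    exact: ctrans cu (crel_sym (ac _ _ aw)).
  by apply: bj cu; apply: ctrans bw.
have zeros : c x None -> j x y.
  move=> cx; have cy := ctrans (crel_sym cxy) cx.
  exact: ctrans (zero x nx cx) (crel_sym (zero y ny cy)).
have [[cx _]|pxy] := congruence_nonzero_parallel cxy; first exact: zeros.
(* When the first step of [u] towards zero is parallel, two of [v], [u], [w] coincide. *)
have direct u v : parallel u v -> near_zero a b u ->
    [\/ u = v, step a b u v | step a b u None].
  move=> puv [w uw w0].
  have [[u0 _]|puw] := step_cases uw; first by constructor 3.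
  by case: (parallel_two (parallel_sym puv) puw) => e; subst;
    [constructor 1 | constructor 2 | constructor 3].
case: (direct x y pxy nx) => [->|xy|x0]; first exact: crel_refl.
  exact: stepj.
case: (direct y x (parallel_sym pxy) ny) => [->|yx|y0]; first exact: crel_refl.
  by apply: stepj cxy; apply: step_sym.
(* Both elements are now one step from zero. A step in [a] brings zero into their [c]-class;
   otherwise [b] relates them through zero. *)
case: x0 => [ax|bx]; first exact/zeros/ac.
case: y0 => [ay|yb]; first exact/zeros/(ctrans cxy)/ac.
by apply: bj cxy; apply: ctrans bx (crel_sym yb).
Qed.

End AtMostTwo.

(** * Three parallel paths in an acyclic quiver *)

Section Acyclic.
Hypothesis hQ : acyclic Q.

Lemma acyclic_closed_path (p : qpath Q) :
  psource p = ptarget p -> parrows p = [::].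
Proof.
move=> e; apply: size0nil; apply/eqP; rewrite -leqn0 leqNgt.
by apply/negP => /hQ.
Qed.

Lemma empty_path_trivial (p : qpath Q) a :
  parrows p = [::] -> ptarget p = a -> p = trivial_path a.
Proof.
move=> ep et; apply: qpath_eq => //=.
by move: (pwalk p); rewrite ep /= => ->.
Qed.

Section Between.
Variables a b : vertex Q.

Definition path_between (x : SQ) : Prop :=
  exists p, [/\ x = Some p, psource p = a & ptarget p = b].

(** This is the largest ideal disjoint from the paths from [a] to [b]. *)
Definition nonfactor (x : SQ) : Prop :=
  forall u v : SQ, ~ path_between (u * x * v).

Lemma nonfactor_mull m x : nonfactor x -> nonfactor (m * x).
Proof. by move=> nx u v; have := nx (u * m) v; rewrite mulgA. Qed.

Lemma nonfactor_mulr m x : nonfactor x -> nonfactor (x * m).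
Proof. by move=> nx u v; have := nx u (m * v); rewrite !mulgA. Qed.

Lemma nonfactor_zero : nonfactor None.
Proof. by move=> u v; rewrite mulp0 mul0p => -[p []]. Qed.

Lemma path_between_factor x : path_between x -> ~ nonfactor x.
Proof.
move=> Tx nx; case: (Tx) => p [ex es et].
apply: (nx (vertex_elt (psource p)) (vertex_elt (ptarget p))).
by rewrite ex trivial_pmul pmul_trivial -ex.
Qed.

(** If [u * m * p * v] and [p] both run from [a] to [b], then [u * m] is a closed path at [a], so it
    is trivial and so is [m]. *)
Lemma path_between_actl m : (forall x, path_between x -> m * x = x) \/
  (forall x, path_between x -> nonfactor (m * x)).
Proof.
have [->|ne] := EM (m = vertex_elt a).
  by left=> x [p [-> <- _]]; apply: trivial_pmul.
right=> x [p [ex es et]] u v; rewrite ex mulgA => -[w [ew sw tw]].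
have [n1 [n2 [e1 [en1 _ wE]]]] := pmul_SomeE ew.
have [n3 [p' [e2 [en3 [ep'] n1E]]]] := pmul_SomeE en1.
have [u' [m' [e3 [_ em' n3E]]]] := pmul_SomeE en3; subst.
have /= := @acyclic_closed_path (pcat e3) _.
move=> /(_ (etrans sw (esym e2))) e.
apply: ne; congr Some; apply: empty_path_trivial => //.
by case: (parrows u') e.
Qed.

Lemma path_between_actr m : (forall x, path_between x -> x * m = x) \/
  (forall x, path_between x -> nonfactor (x * m)).
Proof.
have [->|ne] := EM (m = vertex_elt b).
  by left=> x [p [-> _ <-]]; apply: pmul_trivial.
(* Regrouping isolates [m * v], which would be a closed path at [b]. *)
right=> x [p [ex es et]] u v; rewrite ex mulgA -(mulgA _ m) => -[w [ew sw tw]].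
have [n1 [n2 [e1 [en1 en2 wE]]]] := pmul_SomeE ew.
have [u' [p' [e2 [_ [ep'] n1E]]]] := pmul_SomeE en1.
have [m' [v' [e3 [em' _ n2E]]]] := pmul_SomeE en2; subst.
have /= := @acyclic_closed_path (pcat e3) _.
move=> /(_ (etrans (esym e1) (esym tw))) e.
have em : parrows m' = [::] by case: (parrows m') e.
apply: ne; congr Some; apply: empty_path_trivial => //.
by move: (pwalk m'); rewrite em /= => <-; rewrite -e1.
Qed.

End Between.

Lemma lower_semimodular_at_most_two :
  lower_semimodular (congruence SQ) -> at_most_two_paths Q.
Proof.
move=> lsm a b p q r sp tp sq tq sr tr.
have [|/not_orP[npq /not_orP[npr nqr]]] := EM (p = q \/ p = r \/ q = r) => //.
exfalso.
have T n : psource n = a -> ptarget n = b -> path_between a b (Some n).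
  by move=> ? ?; exists n.
apply: (not_lower_semimodular_ideal (@nonfactor_mull a b)
  (@nonfactor_mulr a b) (path_between_actl a b) (path_between_actr a b)
  (@nonfactor_zero a b) (@path_between_factor a b)
  (T p sp tp) (T q sq tq) (T r sr tr) _ _ _ lsm); by case.
Qed.

End Acyclic.

End PathSemigroup.

Theorem theorem1p3 (Q : quiver) (hQ : acyclic Q) :
  [<-> at_most_two_paths Q;
       modular (congruence (path_semigroup Q));
       strong_lower_semimodular (congruence (path_semigroup Q));
       lower_semimodular (congruence (path_semigroup Q))].
Proof.
tfae.
- exact: at_most_two_modular.
- exact: modular_strong_lower_semimodular.
- exact: strong_lower_semimodular_lower_semimodular.
- exact: lower_semimodular_at_most_two.
Qed.
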